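(* Consider the two-level quantum system with phase damping evolution $L(\rho)=-\gamma(\rho-\sigma_3\rho\sigma_3)$, $\gamma>0$, whose associated vector field on the set of states $\mathcal{D}$ is $Z_L=-2\gamma\left(x_1\frac{\partial}{\partial x_1}+x_2\frac{\partial}{\partial x_2}\right)$, with flow $\Phi^L_t$. For the families of tensor fields $\Lambda_{\mathcal{D},t}=\Phi^L_{t*}\Lambda_{\mathcal{D}}$ and $R_{\mathcal{D},t}=\Phi^L_{t*}R_{\mathcal{D}}$, given by $$\Lambda_{\mathcal{D},t}=e^{-4\gamma t}x_3\frac{\partial}{\partial x_1}\wedge\frac{\partial}{\partial x_2}+x_1\frac{\partial}{\partial x_2}\wedge\frac{\partial}{\partial x_3}+x_2\frac{\partial}{\partial x_3}\wedge\frac{\partial}{\partial x_1},$$ $$R_{\mathcal{D},t}=e^{-4\gamma t}\left(\frac{\partial}{\partial x_1}\otimes\frac{\partial}{\partial x_1}+\frac{\partial}{\partial x_2}\otimes\frac{\partial}{\partial x_2}\right)+\frac{\partial}{\partial x_3}\otimes\frac{\partial}{\partial x_3}-\sum_{j,k=1}^3x_jx_k\frac{\partial}{\partial x_j}\otimes\frac{\partial}{\partial x_k},\qquad t\ge0,$$ the asymptotic limits as $t\to\infty$ exist and are $$\Lambda_{\mathcal{D},\infty}=x_1\frac{\partial}{\partial x_2}\wedge\frac{\partial}{\partial x_3}+x_2\frac{\partial}{\partial x_3}\wedge\frac{\partial}{\partial x_1},\qquad R_{\mathcal{D},\infty}=\frac{\partial}{\partial x_3}\otimes\frac{\partial}{\partial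 x_3}-\sum_{j,k=1}^3x_jx_k\frac{\partial}{\partial x_j}\otimes\frac{\partial}{\partial x_k}.$$ The products of smooth functions on $\mathcal{D}$ defined by $$\{f,g\}_\infty=\Lambda_{\mathcal{D},\infty}(\mathrm{d}f,\mathrm{d}g),\qquad(f,g)_\infty=R_{\mathcal{D},\infty}(\mathrm{d}f,\mathrm{d}g)+fg$$ are a Poisson bracket and a symmetric product, respectively.
   Context: States of the two-level system are the density matrices $\rho=\frac12(I+x_1\sigma_1+x_2\sigma_2+x_3\sigma_3)$, with $\sigma_j$ the Pauli matrices and $x_1^2+x_2^2+x_3^2\le1$; thus $\mathcal{D}$ is the closed unit ball of $\mathbb{R}^3$ with coordinates $(x_1,x_2,x_3)$. The initial tensor fields are $$\Lambda_{\mathcal{D}}=\tfrac12\sum_{j,k,l}\epsilon_{jkl}x_l\frac{\partial}{\partial x_j}\wedge\frac{\partial}{\partial x_k},\qquad R_{\mathcal{D}}=\sum_j\frac{\partial}{\partial x_j}\otimes\frac{\partial}{\partial x_j}-\sum_{j,k}x_jx_k\frac{\partial}{\partial x_j}\otimes\frac{\partial}{\partial x_k},$$ where $v\wedge w=v\otimes w-w\otimes v$. The push-forward by the flow is taken on $\mathbb{R}^3$ and satisfies $\Phi^L_{t*}=e^{-t\mathcal{L}_{Z_L}}$, where $\mathcal{L}$ is the Lie derivative. Limits are pointwise (coefficientwise). *)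

(* Defs.v *)
From mathcomp Require Import all_boot all_order all_algebra.
From mathcomp Require Import complex.
From mathcomp Require Import all_classical all_reals all_analysis.

Set Implicit Arguments.
Unset Strict Implicit.
Unset Printing Implicit Defensive.

Import Order.TTheory GRing.Theory Num.Theory.
Import numFieldNormedType.Exports.

Local Open Scope classical_set_scope.
Local Open Scope complex_scope.
Local Open Scope ring_scope.

(* Coordinates x_1, x_2, x_3 are indexed from 0 in 'I_3. *)
Definition i1 : 'I_3 := @Ordinal 3 0 isT.
Definition i2 : 'I_3 := @Ordinal 3 1 isT.
Definition i3 : 'I_3 := @Ordinal 3 2 isT.

Section TwoLevelSystem.
Variable R : realType.

Definition mx2 (a b c d : R[i]) : 'M[R[i]]_2 :=
  \matrix_(r < 2, s < 2)
    if r == 0 then (if s == 0 then a else b) else (if s == 0 then c else d).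

Definition sigma1 : 'M[R[i]]_2 := mx2 0 1 1 0.
Definition sigma2 : 'M[R[i]]_2 := mx2 0 (0 -i* 1) (0 +i* 1) 0.
Definition sigma3 : 'M[R[i]]_2 := mx2 1 0 0 (- 1).

Definition pauli_vec (v : 'rV[R]_3) : 'M[R[i]]_2 :=
  (v 0 i1)%:C *: sigma1 + (v 0 i2)%:C *: sigma2 + (v 0 i3)%:C *: sigma3.

Definition density (x : 'rV[R]_3) : 'M[R[i]]_2 := 2^-1 *: (1%:M + pauli_vec x).

(* The set of states, in the coordinates given by [density]. *)
Definition bloch_ball : set 'rV[R]_3 := [set x | \sum_(j < 3) x 0 j ^+ 2 <= 1].

Definition phase_damping (gamma : R) (rho : 'M[R[i]]_2) : 'M[R[i]]_2 :=
  - (gamma%:C *: (rho - sigma3 *m rho *m sigma3)).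

(* [L] viewed as a vector field on the states: at [density x] the tangent vector
   [L (density x)] is the image of [Z x] under the differential of [density],
   which is [v |-> 2^-1 *: pauli_vec v]. *)
Definition associated_field (L : 'M[R[i]]_2 -> 'M[R[i]]_2)
    (Z : 'rV[R]_3 -> 'rV[R]_3) : Prop :=
  forall x, bloch_ball x -> L (density x) = 2^-1 *: pauli_vec (Z x).

Definition is_flow (Z : 'rV[R]_3 -> 'rV[R]_3) (Phi : R -> 'rV[R]_3 -> 'rV[R]_3)
    : Prop :=
  (forall x, Phi 0 x = x) /\
  (forall x (t : R), is_derive t (1 : R) (fun s : R => Phi s x) (Z (Phi t x))).

Definition d_ (j : 'I_3) : 'rV[R]_3 := delta_mx 0 j.

Definition Z_damping (gamma : R) (x : 'rV[R]_3) : 'rV[R]_3 :=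
  - (2 * gamma) *: (x 0 i1 *: d_ i1 + x 0 i2 *: d_ i2).

(* A contravariant 2-tensor T is the matrix of its coefficients in the basis
   d_j (x) d_k; a covector is the row of its coefficients in the basis dx_j. *)
Definition tensor_field := 'rV[R]_3 -> 'M[R]_3.

Definition tens (v w : 'rV[R]_3) : 'M[R]_3 := v^T *m w.
Definition wedge (v w : 'rV[R]_3) : 'M[R]_3 := tens v w - tens w v.
Definition eval_tensor (T : 'M[R]_3) (a b : 'rV[R]_3) : R :=
  (a *m T *m b^T) 0 0.

(* [psi] stands for the inverse of [phi].  Since ['J phi p] acts on row vectors
   by right multiplication, this is the bilinear extension of
   [tens v w |-> tens ('d phi p v) ('d phi p w)] at p = psi y. *)
Definition tensor_pushforward (phi psi : 'rV[R]_3 -> 'rV[R]_3) (T : tensor_field)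
    : tensor_field :=
  fun y => ('J phi (psi y))^T *m T (psi y) *m 'J phi (psi y).

Definition levi_civita (j k l : 'I_3) : R :=
  match nat_of_ord j, nat_of_ord k, nat_of_ord l with
  | 0%N, 1%N, 2%N | 1%N, 2%N, 0%N | 2%N, 0%N, 1%N => 1
  | 0%N, 2%N, 1%N | 2%N, 1%N, 0%N | 1%N, 0%N, 2%N => - 1
  | _, _, _ => 0
  end.

Definition Lambda_D : tensor_field := fun x =>
  2^-1 *: \sum_(j < 3) \sum_(k < 3) \sum_(l < 3)
            (levi_civita j k l * x 0 l) *: wedge (d_ j) (d_ k).

Definition R_D : tensor_field := fun x =>
  \sum_(j < 3) tens (d_ j) (d_ j)
  - \sum_(j < 3) \sum_(k < 3) (x 0 j * x 0 k) *: tens (d_ j) (d_ k).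

Definition Lambda_t (gamma t : R) : tensor_field := fun x =>
  (expR (- (4 * gamma * t)) * x 0 i3) *: wedge (d_ i1) (d_ i2)
  + x 0 i1 *: wedge (d_ i2) (d_ i3) + x 0 i2 *: wedge (d_ i3) (d_ i1).

Definition R_t (gamma t : R) : tensor_field := fun x =>
  expR (- (4 * gamma * t)) *: (tens (d_ i1) (d_ i1) + tens (d_ i2) (d_ i2))
  + tens (d_ i3) (d_ i3)
  - \sum_(j < 3) \sum_(k < 3) (x 0 j * x 0 k) *: tens (d_ j) (d_ k).

Definition Lambda_infty : tensor_field := fun x =>
  x 0 i1 *: wedge (d_ i2) (d_ i3) + x 0 i2 *: wedge (d_ i3) (d_ i1).

Definition R_infty : tensor_field := fun x =>
  tens (d_ i3) (d_ i3)
  - \sum_(j < 3) \sum_(k < 3) (x 0 j * x 0 k) *: tens (d_ j) (d_ k).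

Definition tensor_limit (T : R -> tensor_field) (T_infty : tensor_field) : Prop :=
  forall x (j k : 'I_3), T t x j k @[t --> +oo] --> T_infty x j k.

Definition iter_partial (s : seq 'I_3) (F : 'rV[R]_3 -> R) : 'rV[R]_3 -> R :=
  foldr (fun j G => 'D_(d_ j) G) F s.

Definition smooth (F : 'rV[R]_3 -> R) : Prop :=
  forall s : seq 'I_3,
    (forall j x, derivable (iter_partial s F) x (d_ j)) /\
    continuous (iter_partial s F).

Definition grad (F : 'rV[R]_3 -> R) (x : 'rV[R]_3) : 'rV[R]_3 :=
  \row_j 'D_(d_ j) F x.

Definition D_function := set_type bloch_ball -> R.

Definition restrict_D (F : 'rV[R]_3 -> R) : D_function := fun x => F (val x).

(* Smooth functions on the closed ball are restrictions of smooth functions on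
   the whole space (equivalently, on a neighbourhood of the ball). *)
Definition smooth_D : set D_function :=
  [set f | exists2 F, smooth F & restrict_D F = f].

Definition smooth_ext (f : D_function) : 'rV[R]_3 -> R :=
  xget (cst 0) [set F | smooth F /\ restrict_D F = f].

(* The differential at the points of the ball; the choice of the extension is
   irrelevant because the ball is the closure of its interior. *)
Definition diff_D (f : D_function) (x : set_type bloch_ball) : 'rV[R]_3 :=
  grad (smooth_ext f) (val x).

Definition bracket_infty (f g : D_function) : D_function := fun x =>
  eval_tensor (Lambda_infty (val x)) (diff_D f x) (diff_D g x).

Definition product_infty (f g : D_function) : D_function := fun x =>
  eval_tensor (R_infty (val x)) (diff_D f x) (diff_D g x) + f x * g x.

End TwoLevelSystem.

Section ProductsOfFunctions.
Variables (R : realType) (X : Type) (A : set (X -> R)).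
Variable br : (X -> R) -> (X -> R) -> (X -> R).

Definition bilinear_on : Prop :=
  (forall (a : R) f g h, A f -> A g -> A h ->
     br (a *: f + g) h = a *: br f h + br g h) /\
  (forall (a : R) f g h, A f -> A g -> A h ->
     br h (a *: f + g) = a *: br h f + br h g).

Record poisson_bracket_on : Prop := PoissonBracketOn {
  poisson_closed : forall f g, A f -> A g -> A (br f g);
  poisson_bilinear : bilinear_on;
  poisson_antisym : forall f g, A f -> A g -> br f g = - br g f;
  poisson_jacobi : forall f g h, A f -> A g -> A h ->
    br f (br g h) + br g (br h f) + br h (br f g) = 0;
  poisson_leibniz : forall f g h, A f -> A g -> A h ->
    br f (g * h) = br f g * h + g * br f h
}.

Record symmetric_product_on : Prop := SymmetricProductOn {
  symmetric_closed : forall f g, A f -> A g -> A (br f g);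
  symmetric_bilinear : bilinear_on;
  symmetric_comm : forall f g, A f -> A g -> br f g = br g f
}.

End ProductsOfFunctions.

(* Main.v *)
Require Import Defs.
From HB Require Import structures.
From mathcomp Require Import all_boot all_order all_algebra.
From mathcomp Require Import complex.
From mathcomp Require Import all_classical all_reals all_analysis.
From mathcomp Require Import ring.
Set Implicit Arguments.
Unset Strict Implicit.
Unset Printing Implicit Defensive.
Import Order.TTheory GRing.Theory Num.Theory.
Import numFieldNormedType.Exports.
Local Open Scope classical_set_scope.
Local Open Scope ring_scope.

(** The flow is linear, diag(e^(-2 gamma t), e^(-2 gamma t), 1), so the push-forwards are
    computed entrywise and their limits follow from e^(-4 gamma t) --> 0.  Both products are
    given on smooth extensions to the whole space by explicit polynomials in the partial
    derivatives; the gradient of an extension at a point of the closed ball does not depend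
    on the extension because interior points are dense.  The Jacobi identity then reduces
    to a ring identity once mixed partial derivatives commute, which follows from the mean
    value theorem applied to second differences in either order. *)

(** * Directional derivatives along lines and symmetry of mixed derivatives *)

Lemma is_derive_shift_dir (R : realType) (V : normedModType R) (F : V -> R) (w x u : V) :
  derivable F (x + w) u -> is_derive x u (fun y => F (y + w)) ('D_u F (x + w)).
Proof.
have E : (fun h : R => h^-1 *: (((fun y => F (y + w)) \o shift x) (h *: u) - F (x + w)))
  = (fun h : R => h^-1 *: ((F \o shift (x + w)) (h *: u) - F (x + w))).
  by apply/funext => h /=; rewrite addrA.
by move=> dF; split; rewrite /derivable /derive E.
Qed.

(** Turns a directional derivative into an ordinary one, so that the one-variable mean value theorem
    applies along a line. *)
Lemma is_derive_line (R : realType) (V : normedModType R) (F : V -> R) (x u : V) (s : R) :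
  derivable F (x + s *: u) u ->
  is_derive s (1 : R) (fun r : R => F (x + r *: u)) ('D_u F (x + s *: u)).
Proof.
have E : (fun h : R => h^-1 *: (((fun r : R => F (x + r *: u)) \o shift s) (h *: (1 : R))
            - F (x + s *: u)))
  = (fun h : R => h^-1 *: ((F \o shift (x + s *: u)) (h *: u) - F (x + s *: u))).
  apply/funext => h /=; congr (_ *: (F _ - _)).
  by rewrite [h *: 1]mulr1 scalerDl addrCA.
by move=> dF; split; rewrite /derivable /derive E.
Qed.

Lemma mvt_line (R : realType) (V : normedModType R) (F : V -> R) (x u : V) (h : R) :
  0 <= h -> (forall y, derivable F y u) ->
  exists2 s, 0 <= s <= h & F (x + h *: u) - F x = 'D_u F (x + s *: u) * h.
Proof.
move=> h0 dF.
have dline s := is_derive_line (dF (x + s *: u)).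
have cline : {within `[0, h], continuous (fun r => F (x + r *: u))}.
  apply: continuous_subspaceT => s; apply/differentiable_continuous.
  by apply/derivable1_diffP; case: (dline s).
have [s] := MVT_segment h0 (fun s _ => dline s) cline.
by rewrite in_itv/= scale0r addr0 subr0 => sh E; exists s.
Qed.

(* The left-hand side is symmetric in u and v, so the mixed derivatives taken in
   either order agree at points arbitrarily close to x. *)
Lemma mvt_second_difference (R : realType) (V : normedModType R) (F : V -> R)
    (x u v : V) (h : R) :
  0 < h -> (forall y, derivable F y u) -> (forall y, derivable ('D_u F) y v) ->
  exists p : V, `|p - x| <= h * (`|u| + `|v|) /\
    (F (x + h *: u + h *: v) - F (x + h *: u)) - (F (x + h *: v) - F x)
    = 'D_v ('D_u F) p * h ^+ 2.
Proof.
move=> h0 dF ddF; pose G y := F (y + h *: v) - F y.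
have dG y : is_derive y u G ('D_u F (y + h *: v) - 'D_u F y).
  have ? := is_derive_shift_dir (dF (y + h *: v)).
  have ? := derivableP (dF y).
  exact: is_deriveB.
(* The mean value theorem is used twice: for the difference [G] along [u], then for ['D_u F] along
   [v]. *)
have [|s /andP[s0 sh]] := @mvt_line _ _ G x u _ (ltW h0).
  by move=> y; case: (dG y).
rewrite /G addrAC (@derive_val _ _ _ _ _ _ _ (dG _)) => ->.
have [t /andP[t0 th] ->] := mvt_line (x + s *: u) (ltW h0) ddF.
exists (x + s *: u + t *: v); split; last by rewrite expr2 mulrA.
rewrite -(addrA x) addrAC subrr add0r (le_trans (ler_normD _ _))// !normrZ mulrDr.
by rewrite lerD// ler_wpM2r// ger0_norm.
Qed.

Lemma ler_dist_halves (R : realType) (e k l m n : R) :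
  m = n -> `|k - m| <= e / 2 -> `|l - n| <= e / 2 -> `|k - l| <= e.
Proof.
by move=> <- km lm; rewrite (splitr e) (le_trans (ler_distD m _ _))// lerD// distrC.
Qed.

(** One second difference equals [h ^+ 2] times either mixed derivative, taken at points [p] and [q]
    near [x]. By continuity each of these values is within [e / 2] of the corresponding value at
    [x]. *)
Lemma derive_comm (R : realType) (V : normedModType R) (F : V -> R) (u v : V) :
  (forall y, derivable F y u) -> (forall y, derivable F y v) ->
  (forall y, derivable ('D_u F) y v) -> (forall y, derivable ('D_v F) y u) ->
  continuous ('D_v ('D_u F)) -> continuous ('D_u ('D_v F)) ->
  'D_v ('D_u F) = 'D_u ('D_v F).
Proof.
move=> Fu Fv Fuv Fvu cuv cvu; apply/funext => x; apply/eqP; rewrite -subr_eq0 -normr_le0.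
apply/ler_addgt0Pl => e e0; rewrite addr0.
have e2 : 0 < e / 2 by rewrite divr_gt0.
have /cvgrPdist_le /(_ _ e2) /nbhs_normP[r1 /= r10 H1] := cuv x.
have /cvgrPdist_le /(_ _ e2) /nbhs_normP[r2 /= r20 H2] := cvu x.
pose c := `|u| + `|v|; have c0 : 0 <= c by rewrite addr_ge0.
have m0 : 0 < Num.min r1 r2 by rewrite lt_min r10.
(* Small enough to bring [p] and [q] into both neighbourhoods; the summand 1 keeps the denominator
   positive when [c] is 0. *)
pose h := Num.min r1 r2 / (1 + c).
have h0 : 0 < h by rewrite divr_gt0// ltr_pwDl.
have hc : h * c < Num.min r1 r2.
  by rewrite /h mulrAC ltr_pdivrMr ?ltr_pwDl// ltr_pM2l// ltrDr.
have [p [px Ep]] := mvt_second_difference x h0 Fu Fuv.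
have [q [qx Eq]] := mvt_second_difference x h0 Fv Fvu.
have Epq : 'D_v ('D_u F) p = 'D_u ('D_v F) q.
  apply: (@mulIf _ (h ^+ 2)); first by rewrite expf_neq0// gt_eqF.
  have swap (k l m n : R) : k - l - (m - n) = k - m - (l - n) by ring.
  apply: etrans (esym Ep) (etrans _ Eq).
  rewrite (addrAC x (h *: v) (h *: u)).
  exact: swap.
have /H1 /= B1 : `|x - p| < r1.
  by rewrite distrC; apply: le_lt_trans px (lt_le_trans hc _); rewrite ge_min lexx.
have /H2 /= B2 : `|x - q| < r2.
  rewrite distrC; move: qx; rewrite (addrC `|v|) => qx.
  by apply: le_lt_trans qx (lt_le_trans hc _); rewrite ge_min lexx orbT.
exact: ler_dist_halves Epq B1 B2.
Qed.

(** * Smooth functions on the whole space and their ring operations *)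

Lemma iter_partial_rcons (R : realType) (s : seq 'I_3) (j : 'I_3) (F : 'rV[R]_3 -> R) :
  iter_partial (rcons s j) F = iter_partial s ('D_(d_ R j) F).
Proof. by rewrite /iter_partial foldr_rcons. Qed.

Lemma smooth_continuous (R : realType) (F : 'rV[R]_3 -> R) : smooth F -> continuous F.
Proof. by move=> /(_ [::])[]. Qed.

Lemma smooth_derivable (R : realType) (F : 'rV[R]_3 -> R) j x :
  smooth F -> derivable F x (d_ R j).
Proof. by move=> /(_ [::])[]. Qed.

Lemma smooth_partial (R : realType) (F : 'rV[R]_3 -> R) j :
  smooth F -> smooth ('D_(d_ R j) F).
Proof. by move=> sF s; rewrite -iter_partial_rcons. Qed.

Lemma smooth_partial_comm (R : realType) (F : 'rV[R]_3 -> R) j k x : smooth F ->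
  'D_(d_ R k) ('D_(d_ R j) F) x = 'D_(d_ R j) ('D_(d_ R k) F) x.
Proof.
move=> sF.
suff E : 'D_(d_ R k) ('D_(d_ R j) F) = 'D_(d_ R j) ('D_(d_ R k) F).
  exact: (congr1 (fun f => f x) E).
apply: derive_comm => [y|y|y|y||].
- exact: smooth_derivable.
- exact: smooth_derivable.
- exact/smooth_derivable/smooth_partial.
- exact/smooth_derivable/smooth_partial.
- exact/smooth_continuous/smooth_partial/smooth_partial.
- exact/smooth_continuous/smooth_partial/smooth_partial.
Qed.

Lemma derivable_coord (R : realType) (k : 'I_3) (x v : 'rV[R]_3) :
  derivable (fun y : 'rV[R]_3 => y 0 k) x v.
Proof. exact/diff_derivable/differentiable_coord. Qed.

Lemma derive_coord (R : realType) (k : 'I_3) (x v : 'rV[R]_3) :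
  'D_v (fun y : 'rV[R]_3 => y 0 k) x = v 0 k.
Proof.
(* The difference quotient is constant away from [h = 0], and the limit is over punctured
   neighbourhoods. *)
rewrite /derive (_ : (fun h : R => _) = fun h => h^-1 * h * v 0 k).
  apply: cvg_lim => //; apply: (cvg_trans _ (@cvg_cst _ (v 0 k) _ (0 : R)^' _)).
  apply: near_eq_cvg; near=> h; rewrite /cst mulVf ?mul1r//.
  by near: h; exact: nbhs_dnbhs_neq.
by apply/funext => h /=; rewrite !mxE addrK -[_ *: _]/(_ * _) mulrA.
Unshelve. all: by end_near. Qed.

(* Closed under partial derivatives by construction, so that smoothness of sums
   and products follows without tracking iterated Leibniz formulas. *)
Inductive smooth_alg (R : realType) : ('rV[R]_3 -> R) -> Prop :=
| smooth_alg_base F : smooth F -> smooth_alg F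
| smooth_alg_cst (c : R) : smooth_alg (cst c)
| smooth_alg_coord k : smooth_alg (fun x => x 0 k)
| smooth_alg_add F G : smooth_alg F -> smooth_alg G -> smooth_alg (F + G)
| smooth_alg_mul F G : smooth_alg F -> smooth_alg G -> smooth_alg (F * G).

(** The three claims need one joint induction: the Leibniz rule asks for derivability of both
    factors before it can express the partial derivative of a product. *)
Lemma smooth_alg_partial (R : realType) (F : 'rV[R]_3 -> R) : smooth_alg F ->
  [/\ continuous F, forall j x, derivable F x (d_ R j)
    & forall j, smooth_alg ('D_(d_ R j) F)].
Proof.
elim=> {F} [F sF|c|k|F G aF [cF dF pF] aG [cG dG pG]|F G aF [cF dF pF] aG [cG dG pG]].
- split=> [|j x|j]; [exact: smooth_continuous|exact: smooth_derivable|].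
  exact/smooth_alg_base/smooth_partial.
- split=> [|j x|j]; [exact: cst_continuous|exact: derivable_cst|].
  rewrite (_ : 'D_ _ _ = cst 0); first exact: smooth_alg_cst.
  by apply/funext => x; rewrite derive_cst.
- split=> [|j x|j]; [exact: coord_continuous|exact: derivable_coord|].
  rewrite (_ : 'D_ _ _ = cst (d_ R j 0 k)); first exact: smooth_alg_cst.
  by apply/funext => x; rewrite derive_coord.
- split=> [x|j x|j]; [exact: continuousD (cF x) (cG x)|exact: derivableD|].
  rewrite (_ : 'D_ _ _ = 'D_(d_ R j) F + 'D_(d_ R j) G); first exact: smooth_alg_add.
  by apply/funext => x; rewrite deriveD.
- split=> [x|j x|j]; [exact: continuousM (cF x) (cG x)|exact: derivableM|].
  rewrite (_ : 'D_ _ _ = F * 'D_(d_ R j) G + G * 'D_(d_ R j) F).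
    by apply: smooth_alg_add; exact: smooth_alg_mul.
  by apply/funext => x; rewrite deriveM.
Qed.

(** Induction from the right end of [s], where the innermost derivative stands: removing it replaces
    [F] by a partial derivative that is again in the algebra. *)
Lemma smooth_alg_smooth (R : realType) (F : 'rV[R]_3 -> R) : smooth_alg F -> smooth F.
Proof.
move=> aF s; elim/last_ind: s F aF => [|s j IH] F /smooth_alg_partial[cF dF pF].
  by split.
by rewrite iter_partial_rcons; apply: IH.
Qed.

(** * Index computations and coefficients of basis tensors *)

Lemma ord3P (P : 'I_3 -> Prop) : P i1 -> P i2 -> P i3 -> forall j, P j.
Proof.
move=> P1 P2 P3 [[|[|[|//]]] jlt].
- by have -> : Ordinal jlt = i1 by exact: val_inj.
- by have -> : Ordinal jlt = i2 by exact: val_inj.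
- by have -> : Ordinal jlt = i3 by exact: val_inj.
Qed.

Lemma sum3E (V : nmodType) (F : 'I_3 -> V) : \sum_(j < 3) F j = F i1 + F i2 + F i3.
Proof.
rewrite !big_ord_recl big_ord0 addr0 addrA.
by congr (F _ + F _ + F _); exact: val_inj.
Qed.

Lemma tens_dE (R : realType) (a b j k : 'I_3) :
  tens (d_ R a) (d_ R b) j k = (j == a)%:R * (k == b)%:R.
Proof. by rewrite /tens /d_ mxE big_ord1 !mxE eqxx /=. Qed.

Lemma wedge_dE (R : realType) (a b j k : 'I_3) : wedge (d_ R a) (d_ R b) j k =
  (j == a)%:R * (k == b)%:R - (j == b)%:R * (k == a)%:R.
Proof. by rewrite /wedge mxE [X in _ + X]mxE !tens_dE. Qed.

(** * The phase damping vector field and its flow *)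

Lemma phase_damping_field (R : realType) (gamma : R) :
  associated_field (phase_damping gamma) (Z_damping gamma).
Proof.
move=> x _; apply/matrixP => r s.
(* The squared modulus of the complex number 2, which appears when [2^-1] is split into real and
   imaginary parts. *)
have two : (1 + 1) ^+ 2 + (0 + 0) ^+ 2 = 4 :> R by ring.
have cases (P : 'I_2 -> Prop) : P 0 -> P 1 -> forall k, P k.
  move=> P0 P1 [[|[|//]] klt].
    by have -> : Ordinal klt = 0 by exact: val_inj.
  by have -> : Ordinal klt = 1 by exact: val_inj.
rewrite /phase_damping /density /pauli_vec /sigma3 /sigma1 /sigma2 /mx2 /Z_damping /d_.
move: r s; elim/cases; elim/cases; rewrite !(mxE, big_ord_recl, big_ord0) /=.
all: apply/eqP; rewrite eq_complex /=; apply/andP; split; apply/eqP.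
all: by rewrite two; field.
Qed.

(** The boolean multiplicity [*+ (j != i3)] sets the exponent to 0 on the third coordinate, so one
    formula covers all three. *)
Definition damping_flow (R : realType) (gamma t : R) (x : 'rV[R]_3) : 'rV[R]_3 :=
  \row_j (expR (- (2 * gamma * t) *+ (j != i3)) * x 0 j).

Lemma Z_dampingE (R : realType) (gamma : R) (x : 'rV[R]_3) j :
  Z_damping gamma x 0 j = (- (2 * gamma) *+ (j != i3)) * x 0 j.
Proof. by move: j; apply: ord3P; rewrite /Z_damping /d_ !mxE /= ?mulr1n ?mulr0n; ring. Qed.

Lemma is_derive_mx (R : realType) m n (M : R -> 'M[R]_(m, n)) (t : R) (dM : 'M[R]_(m, n)) :
  is_derive t (1 : R) M dM <->
  forall i j, is_derive t (1 : R) (fun s => M s i j) (dM i j).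
Proof.
split=> [[dMt <-] i j|dMt].
  by apply: DeriveDef; [exact: (derivable_mxP _ _ _).1|rewrite derive_mx// mxE].
have dM' : derivable M t 1 by apply/derivable_mxP => i j; case: (dMt i j).
apply: DeriveDef => //; rewrite derive_mx//; apply/matrixP => i j; rewrite mxE.
by case: (dMt i j).
Qed.

Lemma is_derive_expR_lin (R : realType) (a t : R) :
  is_derive t (1 : R) (fun s => expR (a * s)) (a * expR (a * t)).
Proof.
have dl : is_derive t (1 : R) (fun s => a * s) a.
  have := @is_deriveZ _ _ _ id a t 1 1 (is_derive_id _ _).
  by move=> /is_derive_eq; apply; rewrite [_ *: _]mulr1.
by apply: (is_derive_eq (is_derive1_comp _ dl)); rewrite mulrC.
Qed.

(** Integrating factor: [expR (- a * s) * f s] has zero derivative, hence is constant. *)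
Lemma linear_ode_unique (R : realType) (a : R) (f : R -> R) :
  (forall t, is_derive t (1 : R) f (a * f t)) -> forall t, f t = expR (a * t) * f 0.
Proof.
move=> df t; pose g s := expR (- a * s) * f s.
have dg s : is_derive s (1 : R) g 0.
  apply: (is_derive_eq (is_deriveM (is_derive_expR_lin (- a) s) (df s))).
  by rewrite -![_ *: _]/(_ * _); ring.
have := is_derive_0_is_cst t 0 dg; rewrite /g mulr0 expR0 mul1r => <-.
by rewrite mulrA -expRD mulNr subrr expR0 mul1r.
Qed.

Lemma damping_flowP (R : realType) (gamma : R) : is_flow (Z_damping gamma) (damping_flow gamma).
Proof.
split=> [x|x t].
  by apply/rowP => j; rewrite mxE mulr0 oppr0 mul0rn expR0 mul1r.
apply/is_derive_mx => i j; rewrite ord1 Z_dampingE mxE.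
under eq_fun do rewrite mxE -mulNr -mulrnAl.
apply: (is_derive_eq (is_deriveM (is_derive_expR_lin _ _) (is_derive_cst (x 0 j) _ _))).
by rewrite /cst -(mulNr _ t) -(mulrnAl _ t) -![_ *: _]/(_ * _); ring.
Qed.

(** The field is diagonal, so each coordinate of a flow line solves a scalar linear equation. *)
Lemma damping_flow_unique (R : realType) (gamma : R) Phi :
  is_flow (Z_damping gamma) Phi -> Phi = damping_flow gamma.
Proof.
move=> [Phi0 dPhi]; apply/funext => t; apply/funext => x; apply/rowP => j.
have df s : is_derive s (1 : R) (fun s => Phi s x 0 j)
    ((- (2 * gamma) *+ (j != i3)) * Phi s x 0 j).
  by rewrite -Z_dampingE; apply: (is_derive_mx _ _ _).1.
rewrite (linear_ode_unique df) mxE Phi0; congr (expR _ * _).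
by rewrite (mulrnAl _ t) mulNr.
Qed.

(** * Push-forward of the tensor fields *)

Lemma jacobian_damping_flow (R : realType) (gamma t : R) (p : 'rV[R]_3) :
  'J (damping_flow gamma t) p = diag_mx (\row_j expR (- (2 * gamma * t) *+ (j != i3))).
Proof.
pose a (j : 'I_3) := expR (- (2 * gamma * t) *+ (j != i3)).
have df : differentiable (damping_flow gamma t) p.
  have -> : damping_flow gamma t =
      \sum_(j < 3) (fun x : 'rV[R]_3 => (a j *: (fun y : 'rV[R]_3 => y 0 j)) x *: d_ R j).
    apply/funext => x; rewrite {1}[damping_flow gamma t x]row_sum_delta fct_sumE.
    by apply: eq_bigr => j _; rewrite mxE.
  apply: differentiable_sum => j; apply/differentiableZl/differentiableZ.
  exact: differentiable_coord.
(* Row [i] of the Jacobian is the derivative in the direction of the basis vector [d_ R i]. *)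
apply/row_matrixP => i; rewrite row_diag_mx rowE -(deriveEjacobian _ df).
rewrite derive_mx; last exact: diff_derivable.
apply/rowP => j; rewrite !mxE.
under eq_fun do rewrite mxE.
rewrite (_ : (fun x : 'rV[R]_3 => _) = a j *: (fun y : 'rV[R]_3 => y 0 j))//.
rewrite deriveZ ?derive_coord ?mxE; last exact: derivable_coord.
rewrite eqxx eq_sym; case: eqVneq => [->//|_]; exact: (etrans (mulr0 _) (esym (mulr0 _))).
Qed.

(** The Jacobian is diagonal, so each index other than [i3] contributes one factor
    [expR (- (2 * gamma * t))]. *)
Lemma pushforward_damping_flow (R : realType) (gamma t : R) (T : tensor_field R) x j k :
  tensor_pushforward (damping_flow gamma t) (damping_flow gamma (- t)) T x j k =
  expR (- (2 * gamma * t) *+ ((j != i3) + (k != i3))) * T (damping_flow gamma (- t) x) j k.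
Proof.
rewrite /tensor_pushforward jacobian_damping_flow tr_diag_mx mul_mx_diag mul_diag_mx !mxE.
by rewrite mulrAC -expRD mulrnDr.
Qed.

(** Each wedge occurs twice in the sum, the sign of [levi_civita] offsetting antisymmetry; the
    factor [2^-1] removes the double count. *)
Lemma Lambda_DE (R : realType) (x : 'rV[R]_3) : Lambda_D x =
  x 0 i3 *: wedge (d_ R i1) (d_ R i2) + x 0 i1 *: wedge (d_ R i2) (d_ R i3)
  + x 0 i2 *: wedge (d_ R i3) (d_ R i1).
Proof.
rewrite /Lambda_D !sum3E /levi_civita /= !(mul0r, scale0r, addr0, add0r) !(mul1r, mulN1r).
have opp (a b : 'I_3) : wedge (d_ R b) (d_ R a) = - wedge (d_ R a) (d_ R b).
  by rewrite /wedge opprB.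
rewrite (opp i1 i2) (opp i2 i3) (opp i3 i1) !scaleNr !scalerN !opprK.
by move: (wedge _ _) (wedge _ _) (wedge _ _) => u v w; apply/matrixP => j k; rewrite !mxE; field.
Qed.

Lemma quadratic_tensorE (R : realType) (x : 'rV[R]_3) (j k : 'I_3) :
  (\sum_(a < 3) \sum_(b < 3) (x 0 a * x 0 b) *: tens (d_ R a) (d_ R b)) j k = x 0 j * x 0 k.
Proof.
rewrite summxE; under eq_bigr => a _.
  rewrite summxE; under eq_bigr => b _ do rewrite mxE tens_dE.
  over.
by rewrite !sum3E; elim/ord3P: j; elim/ord3P: k; rewrite /=; ring.
Qed.

Lemma Lambda_tE (R : realType) (gamma t : R) (x : 'rV[R]_3) : Lambda_t gamma t x =
  expR (- (4 * gamma * t)) *: (x 0 i3 *: wedge (d_ R i1) (d_ R i2)) + Lambda_infty x.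
Proof. by rewrite /Lambda_t /Lambda_infty scalerA addrA. Qed.

Lemma R_tE (R : realType) (gamma t : R) (x : 'rV[R]_3) : R_t gamma t x =
  expR (- (4 * gamma * t)) *: (tens (d_ R i1) (d_ R i1) + tens (d_ R i2) (d_ R i2)) + R_infty x.
Proof. by rewrite /R_t /R_infty addrA. Qed.

Lemma R_DE (R : realType) (x : 'rV[R]_3) j k : R_D x j k = (j == k)%:R - x 0 j * x 0 k.
Proof.
rewrite /R_D mxE [X in _ + X]mxE quadratic_tensorE; congr (_ - _).
by rewrite sum3E !(tens_dE, mxE); elim/ord3P: j; elim/ord3P: k; rewrite /=; ring.
Qed.

Lemma R_inftyE (R : realType) (x : 'rV[R]_3) j k :
  R_infty x j k = (j == i3)%:R * (k == i3)%:R - x 0 j * x 0 k.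
Proof. by rewrite /R_infty mxE [X in _ + X]mxE quadratic_tensorE tens_dE. Qed.

(** Expresses every exponential through the single nonzero atom [e], which leaves rational
    identities for [field]. *)
Lemma expR_damping (R : realType) (gamma t : R) (e := expR (- (2 * gamma * t))) :
  [/\ e != 0, expR (- (2 * gamma * - t)) = e^-1 & expR (- (4 * gamma * t)) = e ^+ 2].
Proof.
split; first by rewrite gt_eqF ?expR_gt0.
- by rewrite -expRN; congr expR; ring.
- by rewrite -expRM_natl; congr expR; ring.
Qed.

(** On the terms with [i3] the Jacobian factor [e] cancels the [e^-1] coming from the coordinate of
    the inverse flow; on the first wedge the coordinate [x 0 i3] is fixed and [e ^+ 2] remains. *)
Lemma pushforward_Lambda_D (R : realType) (gamma t : R) :
  tensor_pushforward (damping_flow gamma t) (damping_flow gamma (- t)) (@Lambda_D R) =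
  Lambda_t gamma t.
Proof.
have [e0 eN e2] := expR_damping gamma t.
apply/funext => x; apply/matrixP => j k.
rewrite pushforward_damping_flow Lambda_DE /Lambda_t e2.
by move: j k; apply: ord3P; apply: ord3P;
  rewrite !(wedge_dE, mxE) /= ?mulr0n ?mulr1n ?mulr2n ?addn0 ?expRD ?expR0 ?oppr0 ?eN; field.
Qed.

(** The quadratic part is the tensor square of the radial field, which a linear flow preserves; only
    the constant part is rescaled. *)
Lemma pushforward_R_D (R : realType) (gamma t : R) :
  tensor_pushforward (damping_flow gamma t) (damping_flow gamma (- t)) (@R_D R) =
  R_t gamma t.
Proof.
have [e0 eN e2] := expR_damping gamma t.
apply/funext => x; apply/matrixP => j k.
rewrite pushforward_damping_flow R_DE R_tE e2.
by move: j k; apply: ord3P; apply: ord3P;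
  rewrite !(R_inftyE, tens_dE, mxE) /= ?mulr0n ?mulr1n ?mulr2n ?addn0
    ?expRD ?expR0 ?oppr0 ?eN; field.
Qed.

(** * Limits at infinite time *)

Lemma cvg_expR_damping (R : realType) (gamma : R) : 0 < gamma ->
  expR (- (4 * gamma * t)) @[t --> +oo] --> (0 : R).
Proof.
move=> g0; apply: (@cvg_comp _ _ _ (fun t => 4 * gamma * t) (fun s => expR (- s))).
  2: exact: cvgr_expR.
by apply: gt0_cvgMry; [rewrite mulr_gt0|exact: cvg_id].
Qed.

Lemma tensor_limit_damping (R : realType) (gamma : R) (T : R -> tensor_field R)
    (A B : tensor_field R) :
  0 < gamma -> (forall t, 0 <= t -> T t = fun x => expR (- (4 * gamma * t)) *: A x + B x) ->
  tensor_limit T B.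
Proof.
move=> g0 TE x j k.
have : expR (- (4 * gamma * t)) * A x j k + B x j k @[t --> +oo] --> B x j k.
  rewrite -[X in _ --> X]add0r -(mul0r (A x j k)).
  by apply: cvgD; [apply: cvgMl; exact: cvg_expR_damping|exact: cvg_cst].
(* The formula for [T t] is known for [0 <= t] only, which holds eventually at [+oo]. *)
apply: cvg_trans; apply: near_eq_cvg; near=> t.
by rewrite TE// !mxE.
Unshelve. all: by end_near. Qed.

(** * Smooth functions on the ball and independence of the extension *)

Lemma smooth_alg_sub (R : realType) (F G : 'rV[R]_3 -> R) :
  smooth_alg F -> smooth_alg G -> smooth_alg (F - G).
Proof.
move=> aF aG; have -> : F - G = F + cst (-1) * G.
  by apply/funext => x; congr (F x + _); exact: esym (mulN1r _).
by apply: smooth_alg_add => //; apply: smooth_alg_mul => //; exact: smooth_alg_cst.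
Qed.

Lemma smooth_lincomb (R : realType) (a : R) (F G : 'rV[R]_3 -> R) :
  smooth F -> smooth G -> smooth (a *: F + G).
Proof.
move=> sF sG; apply: smooth_alg_smooth.
apply: smooth_alg_add (smooth_alg_base sG).
exact: smooth_alg_mul (smooth_alg_cst a) (smooth_alg_base sF).
Qed.

Lemma smooth_mul (R : realType) (F G : 'rV[R]_3 -> R) :
  smooth F -> smooth G -> smooth (F * G).
Proof.
by move=> sF sG; apply/smooth_alg_smooth/smooth_alg_mul; exact: smooth_alg_base.
Qed.

Lemma continuous_sqnorm (R : realType) :
  continuous (fun x : 'rV[R]_3 => \sum_(j < 3) x 0 j ^+ 2).
Proof.
rewrite (_ : (fun x => _) = \sum_(j < 3) (fun x : 'rV[R]_3 => x 0 j) * (fun x => x 0 j)).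
  apply/smooth_continuous/smooth_alg_smooth; rewrite sum3E.
  by do !apply: smooth_alg_add; apply: smooth_alg_mul; exact: smooth_alg_coord.
by apply/funext => x; rewrite fct_sumE.
Qed.

(** By continuity of the squared norm the strict inequality persists near [x], and a derivative
    depends only on nearby values. *)
Lemma derive_eq_open_ball (R : realType) (F G : 'rV[R]_3 -> R) (v x : 'rV[R]_3) :
  {in @bloch_ball R, F =1 G} -> \sum_(j < 3) x 0 j ^+ 2 < 1 -> 'D_v F x = 'D_v G x.
Proof.
move=> FG x1; apply: near_eq_derive; near=> y; apply/FG/mem_set/ltW.
near: y; move/cvgr_lt: (@continuous_sqnorm R x); exact.
Unshelve. all: by end_near. Qed.

(* Points of the sphere are limits of interior points, where the partial
   derivatives only depend on the restriction to the ball. *)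
Lemma grad_eq_on_ball (R : realType) (F G : 'rV[R]_3 -> R) :
  smooth F -> smooth G -> {in @bloch_ball R, F =1 G} -> {in @bloch_ball R, grad F =1 grad G}.
Proof.
move=> sF sG FG x /set_mem xB; apply/rowP => j; rewrite !mxE.
(* A point of the ball is approached radially by [r *: x] with [r < 1], which lies in the open
   ball. *)
have ray H : smooth H -> 'D_(d_ R j) H (r *: x) @[r --> (1 : R)^'-] --> 'D_(d_ R j) H x.
  move=> sH; apply: cvg_at_left_filter.
  have cD : continuous ('D_(d_ R j) H) by exact/smooth_continuous/smooth_partial.
  have rx : r *: x @[r --> (1 : R)] --> x.
    by rewrite -[X in _ --> X]scale1r; exact: scalel_continuous.
  apply: (cvg_comp (fun r : R => r *: x) ('D_(d_ R j) H) rx).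
  exact: cD.
have := ray G sG; apply: cvg_unique => //.
apply: cvg_trans (ray F sF); apply: near_eq_cvg; near=> r.
apply: derive_eq_open_ball FG _.
have r0 : 0 < r by near: r; exact: nbhs_left_gt.
have r1 : r < 1 by near: r; exact: nbhs_left_lt.
have -> : \sum_(k < 3) (r *: x) 0 k ^+ 2 = r ^+ 2 * \sum_(k < 3) x 0 k ^+ 2.
  by rewrite mulr_sumr; apply: eq_bigr => k _; rewrite mxE exprMn.
rewrite (le_lt_trans (ler_piMr _ xB)) ?sqr_ge0// expr_lt1 ?ltW//.
Unshelve. all: by end_near. Qed.

Lemma restrict_D_inj (R : realType) (F G : 'rV[R]_3 -> R) :
  restrict_D F = restrict_D G -> {in @bloch_ball R, F =1 G}.
Proof. by move=> FG x xB; have := congr1 (fun f => f (SigSub xB)) FG. Qed.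

Lemma diff_D_restrict (R : realType) (F : 'rV[R]_3 -> R) x :
  smooth F -> diff_D (restrict_D F) x = grad F (val x).
Proof.
(* [F] itself is an admissible extension, so [xget] returns a smooth extension and not merely its
   default [cst 0]. *)
move=> sF; have [sE EF] : smooth (smooth_ext (restrict_D F)) /\
    restrict_D (smooth_ext (restrict_D F)) = restrict_D F.
  by apply: (@xgetPex _ (cst 0) [set E | smooth E /\ restrict_D E = restrict_D F]); exists F.
exact: grad_eq_on_ball sE sF (restrict_D_inj EF) _ (valP x).
Qed.

(** * The two products in terms of partial derivatives of extensions *)

Lemma eval_tensorE (R : realType) (T : 'M[R]_3) (a b : 'rV[R]_3) :
  eval_tensor T a b = \sum_(j < 3) \sum_(k < 3) a 0 j * T j k * b 0 k.
Proof.
rewrite /eval_tensor mxE exchange_big; apply: eq_bigr => k _.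
by rewrite !mxE mulr_suml.
Qed.

Lemma eval_Lambda_infty (R : realType) (x a b : 'rV[R]_3) : eval_tensor (Lambda_infty x) a b =
  x 0 i1 * (a 0 i2 * b 0 i3 - a 0 i3 * b 0 i2) + x 0 i2 * (a 0 i3 * b 0 i1 - a 0 i1 * b 0 i3).
Proof. by rewrite eval_tensorE !sum3E /Lambda_infty !(wedge_dE, mxE) /=; ring. Qed.

Lemma eval_R_infty (R : realType) (x a b : 'rV[R]_3) : eval_tensor (R_infty x) a b =
  a 0 i3 * b 0 i3 - (\sum_(j < 3) x 0 j * a 0 j) * (\sum_(j < 3) x 0 j * b 0 j).
Proof. by rewrite eval_tensorE !sum3E !R_inftyE /=; ring. Qed.

(* Locked: otherwise [rewrite] and [ring] compare distinct partial derivatives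
   by unfolding the limits that define them. *)
HB.lock Definition partial (R : realType) (j : 'I_3) (F : 'rV[R]_3 -> R) : 'rV[R]_3 -> R :=
  'D_(d_ R j) F.

Lemma gradE (R : realType) (F : 'rV[R]_3 -> R) x j : grad F x 0 j = partial j F x.
Proof. by rewrite mxE partial.unlock. Qed.

Lemma partial_smooth (R : realType) (F : 'rV[R]_3 -> R) j : smooth F -> smooth (partial j F).
Proof. by rewrite partial.unlock; exact: smooth_partial. Qed.

Lemma is_derive_partial (R : realType) (j : 'I_3) (F : 'rV[R]_3 -> R) x : smooth F ->
  is_derive x (d_ R j) F (partial j F x).
Proof. by move=> sF; rewrite partial.unlock; apply: derivableP; exact: smooth_derivable. Qed.

Lemma partial_val (R : realType) (j : 'I_3) (F : 'rV[R]_3 -> R) x dF :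
  is_derive x (d_ R j) F dF -> partial j F x = dF.
Proof. by rewrite partial.unlock => -[]. Qed.

Lemma partial_comm (R : realType) (F : 'rV[R]_3 -> R) j k : smooth F ->
  partial k (partial j F) = partial j (partial k F).
Proof. by move=> sF; apply/funext => x; rewrite partial.unlock; exact: smooth_partial_comm. Qed.

(** This is the Lie-Poisson bracket of the Euclidean algebra of the plane: the coordinates satisfy
    {x_2, x_3} = x_1, {x_3, x_1} = x_2, {x_1, x_2} = 0. Ring operations on functions are used so
    that the constructors of [smooth_alg] apply. *)
Definition poisson (R : realType) (F G : 'rV[R]_3 -> R) : 'rV[R]_3 -> R :=
  (fun x : 'rV[R]_3 => x 0 i1) * (partial i2 F * partial i3 G - partial i3 F * partial i2 G) +
  (fun x : 'rV[R]_3 => x 0 i2) * (partial i3 F * partial i1 G - partial i1 F * partial i3 G).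

Lemma poissonE (R : realType) (F G : 'rV[R]_3 -> R) x : poisson F G x =
  x 0 i1 * (partial i2 F x * partial i3 G x - partial i3 F x * partial i2 G x) +
  x 0 i2 * (partial i3 F x * partial i1 G x - partial i1 F x * partial i3 G x).
Proof. by []. Qed.

(** The radial (Euler) vector field acting on [F]; its tensor square is the quadratic part of
    [R_infty]. *)
Definition euler (R : realType) (F : 'rV[R]_3 -> R) : 'rV[R]_3 -> R :=
  \sum_(j < 3) (fun x : 'rV[R]_3 => x 0 j) * partial j F.

Lemma eulerE (R : realType) (F : 'rV[R]_3 -> R) x :
  euler F x = \sum_(j < 3) x 0 j * partial j F x.
Proof. by rewrite /euler fct_sumE. Qed.

Definition sym_product (R : realType) (F G : 'rV[R]_3 -> R) : 'rV[R]_3 -> R :=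
  partial i3 F * partial i3 G - euler F * euler G + F * G.

Lemma sym_productE (R : realType) (F G : 'rV[R]_3 -> R) x : sym_product F G x =
  partial i3 F x * partial i3 G x - euler F x * euler G x + F x * G x.
Proof. by []. Qed.

Lemma smooth_alg_derive (R : realType) (F : 'rV[R]_3 -> R) j :
  smooth F -> smooth_alg (partial j F).
Proof. by move=> sF; apply/smooth_alg_base/partial_smooth. Qed.

Lemma smooth_poisson (R : realType) (F G : 'rV[R]_3 -> R) :
  smooth F -> smooth G -> smooth (poisson F G).
Proof.
move=> sF sG; apply: smooth_alg_smooth.
by apply: smooth_alg_add; (apply: smooth_alg_mul; first exact: smooth_alg_coord);
  apply: smooth_alg_sub; apply: smooth_alg_mul; exact: smooth_alg_derive.
Qed.

Lemma smooth_alg_euler (R : realType) (F : 'rV[R]_3 -> R) : smooth F -> smooth_alg (euler F).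
Proof.
move=> sF; rewrite /euler sum3E.
by do !apply: smooth_alg_add; apply: smooth_alg_mul;
  by [exact: smooth_alg_coord|exact: smooth_alg_derive].
Qed.

Lemma smooth_sym_product (R : realType) (F G : 'rV[R]_3 -> R) :
  smooth F -> smooth G -> smooth (sym_product F G).
Proof.
move=> sF sG; apply: smooth_alg_smooth; apply: smooth_alg_add; last first.
  by apply: smooth_alg_mul; exact: smooth_alg_base.
apply: smooth_alg_sub; apply: smooth_alg_mul.
- exact: smooth_alg_derive.
- exact: smooth_alg_derive.
- exact: smooth_alg_euler.
- exact: smooth_alg_euler.
Qed.

(** Moves every identity for the bracket on the ball to smooth functions on the whole space. *)
Lemma bracket_restrict (R : realType) (F G : 'rV[R]_3 -> R) : smooth F -> smooth G ->
  bracket_infty (restrict_D F) (restrict_D G) = restrict_D (poisson F G).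
Proof.
move=> sF sG; apply/funext => x; rewrite /bracket_infty !diff_D_restrict//.
by rewrite eval_Lambda_infty !gradE.
Qed.

Lemma product_restrict (R : realType) (F G : 'rV[R]_3 -> R) : smooth F -> smooth G ->
  product_infty (restrict_D F) (restrict_D G) = restrict_D (sym_product F G).
Proof.
move=> sF sG; apply/funext => x; rewrite /product_infty !diff_D_restrict//.
rewrite eval_R_infty !gradE /restrict_D sym_productE !eulerE.
by congr (_ - _ * _ + _); apply: eq_bigr => j _; rewrite gradE.
Qed.

(** * Algebraic identities of the products on the whole space *)

Lemma is_derive_mul_minor (R : realType) (V : normedModType R) (u a b c d : V -> R) (x v : V)
    (du da db dc dd : R) :
  is_derive x v u du -> is_derive x v a da -> is_derive x v b db ->
  is_derive x v c dc -> is_derive x v d dd ->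
  is_derive x v (u * (a * b - c * d))
    (du * (a x * b x - c x * d x) + u x * (da * b x + a x * db - dc * d x - c x * dd)).
Proof.
move=> Du Da Db Dc Dd.
apply: (is_derive_eq (is_deriveM Du (is_deriveB (is_deriveM Da Db) (is_deriveM Dc Dd)))).
by rewrite -![_ *: _]/(_ * _) !fctE; ring.
Qed.

(** Leibniz rule for the bracket; the two indicator terms come from differentiating the coefficients
    [x 0 i1] and [x 0 i2]. *)
Lemma derive_poisson (R : realType) (F G : 'rV[R]_3 -> R) j x : smooth F -> smooth G ->
  partial j (poisson F G) x =
    (j == i1)%:R * (partial i2 F x * partial i3 G x - partial i3 F x * partial i2 G x) +
    (j == i2)%:R * (partial i3 F x * partial i1 G x - partial i1 F x * partial i3 G x) +
    poisson (partial j F) G x + poisson F (partial j G) x.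
Proof.
move=> sF sG.
have dX k : is_derive x (d_ R j) (fun y : 'rV[R]_3 => y 0 k) (j == k)%:R.
  split; first exact: derivable_coord.
  by rewrite derive_coord /d_ mxE eqxx eq_sym.
(* The derivatives are commuted into the order in which they occur in [poisson (partial j F) G]. *)
have dD H k : smooth H ->
    is_derive x (d_ R j) (partial k H) (partial k (partial j H) x).
  move=> sH; rewrite (partial_comm _ _ sH); apply: is_derive_partial.
  exact: partial_smooth.
have dF k := dD F k sF; have dG k := dD G k sG.
have D := is_deriveD (is_derive_mul_minor (dX i1) (dF i2) (dG i3) (dF i3) (dG i2))
  (is_derive_mul_minor (dX i2) (dF i3) (dG i1) (dF i1) (dG i3)).
apply: etrans (partial_val D) _.
rewrite !poissonE.
ring.
Qed.

Lemma partialM (R : realType) (F G : 'rV[R]_3 -> R) j x : smooth F -> smooth G ->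
  partial j (F * G) x = F x * partial j G x + G x * partial j F x.
Proof.
move=> sF sG.
exact: partial_val (is_deriveM (is_derive_partial j x sF) (is_derive_partial j x sG)).
Qed.

Lemma partial_lincomb (R : realType) (a : R) (F G : 'rV[R]_3 -> R) j x : smooth F -> smooth G ->
  partial j (a *: F + G) x = a * partial j F x + partial j G x.
Proof.
move=> sF sG; apply: partial_val.
exact: is_deriveD (is_deriveZ a (is_derive_partial j x sF)) (is_derive_partial j x sG).
Qed.

Lemma poisson_lincomb (R : realType) (a : R) (F G H : 'rV[R]_3 -> R) :
  smooth F -> smooth G -> poisson (a *: F + G) H = a *: poisson F H + poisson G H.
Proof.
move=> sF sG; apply/funext => x.
rewrite -[RHS]/(a * poisson F H x + poisson G H x) !poissonE !partial_lincomb//.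
ring.
Qed.

Lemma sym_product_lincomb (R : realType) (a : R) (F G H : 'rV[R]_3 -> R) :
  smooth F -> smooth G -> sym_product (a *: F + G) H = a *: sym_product F H + sym_product G H.
Proof.
move=> sF sG; apply/funext => x.
rewrite -[RHS]/(a * sym_product F H x + sym_product G H x) !sym_productE !eulerE !sum3E.
rewrite -[(a *: F + G) x]/(a * F x + G x) !partial_lincomb//.
ring.
Qed.

Lemma sym_productC (R : realType) (F G : 'rV[R]_3 -> R) : sym_product F G = sym_product G F.
Proof. by apply/funext => x; rewrite !sym_productE; ring. Qed.

Lemma poisson_anticomm (R : realType) (F G : 'rV[R]_3 -> R) : poisson F G = - poisson G F.
Proof.
by apply/funext => x; rewrite -[RHS]/(- poisson G F x) !poissonE; ring.
Qed.

Lemma poisson_mulr (R : realType) (F G H : 'rV[R]_3 -> R) : smooth G -> smooth H ->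
  poisson F (G * H) = poisson F G * H + G * poisson F H.
Proof.
move=> sG sH; apply/funext => x.
rewrite -[RHS]/(poisson F G x * H x + G x * poisson F H x) !poissonE.
rewrite !partialM//.
ring.
Qed.

Lemma poisson_jacobi_identity (R : realType) (F G H : 'rV[R]_3 -> R) :
  smooth F -> smooth G -> smooth H ->
  poisson F (poisson G H) + poisson G (poisson H F) + poisson H (poisson F G) = 0.
Proof.
move=> sF sG sH; apply/funext => x.
rewrite -[LHS]/(poisson F (poisson G H) x + poisson G (poisson H F) x
                + poisson H (poisson F G) x) -[RHS]/(0 : R).
rewrite (poissonE F (poisson G H)) (poissonE G (poisson H F)) (poissonE H (poisson F G)).
rewrite !(derive_poisson _ _ sG sH).
rewrite !(derive_poisson _ _ sH sF).
rewrite !(derive_poisson _ _ sF sG).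
rewrite !poissonE.
(* Mixed derivatives are put in one order, smaller index outermost, so that [ring] sees equal ones
   as the same atom and the second-order terms cancel. *)
rewrite !(partial_comm i1 i2 sF, partial_comm i1 i3 sF, partial_comm i2 i3 sF).
rewrite !(partial_comm i1 i2 sG, partial_comm i1 i3 sG, partial_comm i2 i3 sG).
rewrite !(partial_comm i1 i2 sH, partial_comm i1 i3 sH, partial_comm i2 i3 sH).
rewrite /=; ring.
Qed.

(** * Transfer to smooth functions on the ball *)

Lemma smooth_D_restrict (R : realType) (F : 'rV[R]_3 -> R) : smooth F -> smooth_D (restrict_D F).
Proof. by exists F. Qed.

Lemma bracket_infty_poisson (R : realType) : poisson_bracket_on (@smooth_D R) (@bracket_infty R).
Proof.
have lin (a : R) f g h : smooth_D f -> smooth_D g -> smooth_D h ->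
    bracket_infty (a *: f + g) h = a *: bracket_infty f h + bracket_infty g h.
  move=> [F sF <-] [G sG <-] [H sH <-].
  (* Restriction commutes with the pointwise operations by conversion. *)
  rewrite -[a *: _ + _]/(restrict_D (a *: F + G)) !bracket_restrict//; last exact: smooth_lincomb.
  by rewrite poisson_lincomb.
have anti (f g : D_function R) : smooth_D f -> smooth_D g ->
    bracket_infty f g = - bracket_infty g f.
  by move=> [F sF <-] [G sG <-]; rewrite !bracket_restrict// poisson_anticomm.
split=> //.
- move=> _ _ [F sF <-] [G sG <-]; rewrite bracket_restrict//.
  exact/smooth_D_restrict/smooth_poisson.
(* Linearity in the second argument follows from the first by antisymmetry. *)
- split=> // a f g h sf sg sh; rewrite anti//; last first.
    move: sf sg => [F sF <-] [G sG <-].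
    exact: smooth_D_restrict (smooth_lincomb a sF sG).
  by rewrite lin// (anti h f)// (anti h g)// opprD scalerN.
- move=> _ _ _ [F sF <-] [G sG <-] [H sH <-].
  rewrite (bracket_restrict sG sH) (bracket_restrict sH sF) (bracket_restrict sF sG).
  rewrite (bracket_restrict sF (smooth_poisson sG sH)).
  rewrite (bracket_restrict sG (smooth_poisson sH sF)).
  rewrite (bracket_restrict sH (smooth_poisson sF sG)).
  by rewrite -[LHS]/(restrict_D (poisson F (poisson G H) + poisson G (poisson H F) +
    poisson H (poisson F G))) poisson_jacobi_identity.
- move=> _ _ _ [F sF <-] [G sG <-] [H sH <-].
  rewrite -[restrict_D G * _]/(restrict_D (G * H)).
  by rewrite (bracket_restrict sF (smooth_mul sG sH)) poisson_mulr// !bracket_restrict.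
Qed.

Lemma product_infty_symmetric (R : realType) :
  symmetric_product_on (@smooth_D R) (@product_infty R).
Proof.
have lin (a : R) f g h : smooth_D f -> smooth_D g -> smooth_D h ->
    product_infty (a *: f + g) h = a *: product_infty f h + product_infty g h.
  move=> [F sF <-] [G sG <-] [H sH <-].
  rewrite -[a *: _ + _]/(restrict_D (a *: F + G)) !product_restrict//; last exact: smooth_lincomb.
  by rewrite sym_product_lincomb.
have sym (f g : D_function R) : smooth_D f -> smooth_D g -> product_infty f g = product_infty g f.
  by move=> [F sF <-] [G sG <-]; rewrite !product_restrict// sym_productC.
split=> //.
- move=> _ _ [F sF <-] [G sG <-]; rewrite product_restrict//.
  exact/smooth_D_restrict/smooth_sym_product.
- split=> // a f g h sf sg sh; rewrite sym//; last first.
    move: sf sg => [F sF <-] [G sG <-].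
    exact: smooth_D_restrict (smooth_lincomb a sF sG).
  by rewrite lin// (sym f)// (sym g).
Qed.

Theorem theorem5p4 (R : realType) (gamma : R) (gamma_gt0 : 0 < gamma) :
  associated_field (phase_damping gamma) (Z_damping gamma) /\
  (exists Phi, is_flow (Z_damping gamma) Phi) /\
  (forall Phi, is_flow (Z_damping gamma) Phi ->
     (forall t : R, 0 <= t ->
        tensor_pushforward (Phi t) (Phi (- t)) (@Lambda_D R) = Lambda_t gamma t /\
        tensor_pushforward (Phi t) (Phi (- t)) (@R_D R) = R_t gamma t) /\
     tensor_limit (fun t => tensor_pushforward (Phi t) (Phi (- t)) (@Lambda_D R))
       (@Lambda_infty R) /\
     tensor_limit (fun t => tensor_pushforward (Phi t) (Phi (- t)) (@R_D R))
       (@R_infty R)) /\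
  (forall F : 'rV[R]_3 -> R, smooth F ->
     forall x, diff_D (restrict_D F) x = grad F (val x)) /\
  poisson_bracket_on (@smooth_D R) (@bracket_infty R) /\
  symmetric_product_on (@smooth_D R) (@product_infty R).
Proof.
split; first exact: phase_damping_field.
split; first by exists (damping_flow gamma); exact: damping_flowP.
split.
  (* Uniqueness replaces an arbitrary flow by the explicit one. *)
  move=> _ /damping_flow_unique->; split.
    by move=> t _; rewrite pushforward_Lambda_D pushforward_R_D.
  split; apply: (tensor_limit_damping gamma_gt0) => t _.
    by rewrite pushforward_Lambda_D; apply/funext => x; exact: Lambda_tE.
  by rewrite pushforward_R_D; apply/funext => x; exact: R_tE.
split; first by move=> F sF x; exact: diff_D_restrict.
split; [exact: bracket_infty_poisson|exact: product_infty_symmetric].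
Qed.
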